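(* Let $\lambda_1,\lambda_2,\lambda_1',\lambda_2',\sigma_1,\sigma_2,\sigma_1',\sigma_2'\in\mathbb{C}^*$ and $\eta_1,\eta_2,\eta_1',\eta_2'\in\mathbb{C}$ with $\lambda_1\neq\lambda_2$ and $\lambda_1'\neq\lambda_2'$. Then the irreducible $\mathcal{G}$-modules $\Omega(\lambda_1,\eta_1,\sigma_1,0)\otimes\Omega(\lambda_2,\eta_2,\sigma_2,0)$ and $\Omega(\lambda_1',\eta_1',\sigma_1',0)\otimes\Omega(\lambda_2',\eta_2',\sigma_2',0)$ are isomorphic if and only if either $(\lambda_1,\eta_1,\sigma_1)=(\lambda_1',\eta_1',\sigma_1')$ and $(\lambda_2,\eta_2,\sigma_2)=(\lambda_2',\eta_2',\sigma_2')$, or $(\lambda_1,\eta_1,\sigma_1)=(\lambda_2',\eta_2',\sigma_2')$ and $(\lambda_2,\eta_2,\sigma_2)=(\lambda_1',\eta_1',\sigma_1')$.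
   Context: The planar Galilean conformal algebra $\mathcal{G}$ is the complex Lie algebra with basis $\{L_m,H_m,I_m,J_m\mid m\in\mathbb{Z}\}$ and brackets $[L_m,L_n]=(n-m)L_{m+n}$, $[L_m,H_n]=nH_{m+n}$, $[L_m,I_n]=(n-m)I_{m+n}$, $[L_m,J_n]=(n-m)J_{m+n}$, $[H_m,I_n]=I_{m+n}$, $[H_m,J_n]=-J_{m+n}$, and $[H_m,H_n]=[I_m,I_n]=[J_m,J_n]=[I_m,J_n]=0$ for all $m,n\in\mathbb{Z}$. For $\lambda,\sigma\in\mathbb{C}^*$, $\eta\in\mathbb{C}$, the module $\Omega(\lambda,\eta,\sigma,0)$ is $\mathbb{C}[X,Y]$ with $L_m f(X,Y)=\lambda^m(Y-mX+m\eta)f(X,Y-m)$, $H_m f(X,Y)=\lambda^m X f(X,Y-m)$, $I_m f(X,Y)=\lambda^m\sigma f(X-1,Y-m)$, $J_m f(X,Y)=0$. The tensor product of $\mathcal{G}$-modules has action $x(v\otimes w)=xv\otimes w+v\otimes xw$. (When $\lambda_1\neq\lambda_2$ these tensor products are irreducible.) *)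

(* Defs.v *)
From HB Require Import structures.
From mathcomp Require Import all_boot all_order all_algebra.
From mathcomp Require Import reals.
From mathcomp Require Import complex.
From mathcomp Require Import mpoly.
Set Implicit Arguments. Unset Strict Implicit. Unset Printing Implicit Defensive.
Import GRing.Theory.
Local Open Scope ring_scope.

(* Basis types of the planar Galilean conformal algebra G:
   L_m, H_m, I_m, J_m for m : int. *)
Inductive gca_gen := GL | GH | GI | GJ.

(* Carrier of Omega(l1,e1,s1,0) (x) Omega(l2,e2,s2,0):
   C[X1,Y1] (x) C[X2,Y2] = C[X1,Y1,X2,Y2], variables indexed
   X1 = 0, Y1 = 1, X2 = 2, Y2 = 3. *)
Definition P4 (R : realType) := {mpoly R[i][4]}.

Definition vX (k : bool) : 'I_4 := if k then @Ordinal 4 2 isT else @Ordinal 4 0 isT.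
Definition vY (k : bool) : 'I_4 := if k then @Ordinal 4 3 isT else @Ordinal 4 1 isT.

Definition shift (R : realType) (k : bool) (a b : R[i]) (f : P4 R) : P4 R :=
  f \mPo [tuple
    (if k then 'X_(vX false) else 'X_(vX false) - a%:MP);
    (if k then 'X_(vY false) else 'X_(vY false) - b%:MP);
    (if k then 'X_(vX true) - a%:MP else 'X_(vX true));
    (if k then 'X_(vY true) - b%:MP else 'X_(vY true))].

Definition omega_act (R : realType) (k : bool) (l e s : R[i])
    (g : gca_gen) (m : int) (f : P4 R) : P4 R :=
  match g with
  | GL => l ^ m *: (('X_(vY k) - m%:~R *: 'X_(vX k) + (m%:~R * e)%:MP)
                      * shift k 0 m%:~R f)
  | GH => l ^ m *: ('X_(vX k) * shift k 0 m%:~R f)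
  | GI => (l ^ m * s) *: shift k 1 m%:~R f
  | GJ => 0
  end.

(* Action on Omega(l1,e1,s1,0) (x) Omega(l2,e2,s2,0):
   x (v (x) w) = x v (x) w + v (x) x w. *)
Definition tensor_act (R : realType) (l1 e1 s1 l2 e2 s2 : R[i])
    (g : gca_gen) (m : int) (f : P4 R) : P4 R :=
  omega_act false l1 e1 s1 g m f + omega_act true l2 e2 s2 g m f.

(* Isomorphism of G-modules: a C-linear bijection commuting with the
   action of every basis element of G (hence of all of G). *)
Definition gmod_isomorphic (R : realType)
    (act act' : gca_gen -> int -> P4 R -> P4 R) : Prop :=
  exists phi : P4 R -> P4 R,
    [/\ (forall (a : R[i]) (u v : P4 R), phi (a *: u + v) = a *: phi u + phi v),
        bijective phi &
        (forall g m f, phi (act g m f) = act' g m (phi f))].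

(* Main.v *)
Require Import Defs.
From HB Require Import structures.
From mathcomp Require Import all_boot all_order all_algebra.
From mathcomp Require Import reals.
From mathcomp Require Import complex.
From mathcomp Require Import mpoly.
Import GRing.Theory.
Local Open Scope ring_scope.

(** Let [phi] be an isomorphism and [P = phi 1]. As [I_m] acts on [1] by the
scalar [l1^m s1 + l2^m s2], the sum of [l1'^m s1' P(X1 - 1, Y1 - m, X2, Y2)]
and [l2'^m s2' P(X1, Y1, X2 - 1, Y2 - m)] is [(l1^m s1 + l2^m s2) P] for all
[m]. Exponential polynomials in [m] with distinct bases are linearly
independent, so the bases agree up to order; after exchanging the two tensor
factors if necessary, [l1 = l1'] and [l2 = l2']. Comparing coefficients then
shows that [P] is an eigenvector of the shifts, which forces [s1 = s1'],
[s2 = s2'] and the invariance of [P] under the shifts of [Y1] and [Y2].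
Applying [phi] to [H_m 1] and to [L_m 1] and separating the exponential
polynomials once more yields [phi(Xi) = Xi P], and then [e1 = e1'] and
[e2 = e2']. *)

(** * Linear independence of exponential polynomials over a domain of characteristic zero *)

Section ExpPoly.

Variable D : idomainType.
Hypothesis char0 : has_char0 D.

Lemma poly_nat_eq0 (p : {poly D}) : (forall n : nat, p.[n%:R] = 0) -> p = 0.
Proof.
move=> p0; apply/eqP/negPn/negP => nz.
have inj : injective (fun n : nat => n%:R : D).
  move=> m n /= mn; wlog le_mn : m n mn / (m <= n)%N.
    by case/orP: (leq_total m n) => h H; [exact: H | apply/esym/H].
  apply/eqP; rewrite eqn_leq le_mn /= -subn_eq0 -((pcharf0P D).1 char0).
  by rewrite natrB // mn subrr.
(* The naturals below [size p] would be [size p] distinct roots, one more than the degree allows. *)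
have := @max_poly_roots _ p [seq n%:R | n <- iota 0 (size p)] nz.
rewrite size_map size_iota ltnn map_inj_uniq // iota_uniq.
move=> H; suff: false by [].
by apply: H => //; apply/allP => _ /mapP [n _ ->]; apply/rootP.
Qed.

Let succ (p : {poly D}) := p \Po ('X + 1%:P).

Let size_succ p : size (succ p) = size p.
Proof. by rewrite /succ size_comp_poly2 // size_XaddC. Qed.

Let lead_succ p : lead_coef (succ p) = lead_coef p.
Proof.
by rewrite /succ lead_coef_comp ?size_XaddC // lead_coefDl
  ?lead_coefX ?expr1n ?mulr1 // size_polyX size_polyC oner_eq0.
Qed.

Let horner_succ p n : (succ p).[n%:R] = p.[n.+1%:R].
Proof. by rewrite /succ horner_comp !hornerE -natr1. Qed.

(* The operator [u |-> u(n+1) - a u(n)] lowers the degree of the polynomial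
   attached to the base [a] and preserves that of the other ones. *)
Lemma exp_poly_uniq (s : seq (D * {poly D})) :
    all (fun q => q.1 != 0) s -> uniq (unzip1 s) ->
    (forall n : nat, \sum_(q <- s) q.1 ^+ n * q.2.[n%:R] = 0) ->
  all (fun q => q.2 == 0) s.
Proof.
move: {2}(size s) (erefl (size s)) => k.
elim: k s => [|k IH] [|[a p] s] //= [sz_s].
(* Inside the induction on the number of bases, a second one bounds the size of the head polynomial.
   At bound zero the head vanishes and the outer hypothesis handles the tail. *)
move: {2}(size p) (leqnn (size p)) => N.
elim: N p s sz_s => [|N IHN] p s sz_s le_p /andP[a0 s0] /andP[as_ us] E.
  have p0 : p = 0 by apply/eqP; rewrite -size_poly_eq0 -leqn0.
  rewrite p0 eqxx /=; apply: IH => // n.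
  by have := E n; rewrite big_cons p0 /= horner0 mulr0 add0r.
pose T (b : D) q := b *: succ q - a *: q.
pose s' := [seq (q.1, T q.1 q.2) | q <- s].
have s'1 : unzip1 s' = unzip1 s by rewrite /unzip1 -map_comp.
have sz' : (size (T a p) <= N)%N.
  rewrite /T -scalerBr (leq_trans (size_scale_leq _ _)) //.
  have [->|p0] := eqVneq p 0.
    by rewrite /succ comp_poly0 subrr size_poly0.
  rewrite -ltnS (leq_trans _ le_p) // ltn_neqAle; apply/andP; split; last first.
    by rewrite (leq_trans (size_polyD _ _)) // size_polyN size_succ maxnn.
  have lt0 : (0 < size p)%N by rewrite size_poly_gt0.
  (* If the size did not drop, the leading coefficient of [succ p - p] would be the difference of
     two equal leading coefficients, hence zero. *)
  apply/negP => /eqP h.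
  have: lead_coef (succ p - p) = 0.
    rewrite lead_coefE h coefB -[in X in X - _](size_succ p).
    by rewrite -!lead_coefE lead_succ subrr.
  by move/eqP; rewrite lead_coef_eq0 -size_poly_eq0 h -leqn0 leqNgt lt0.
have := IHN (T a p) s' _ sz'.
rewrite size_map s'1 as_ us a0 /= all_map => /(_ sz_s s0 isT) H.
have /H/andP[_ /allP all0] : forall n : nat,
    \sum_(q <- (a, T a p) :: s') q.1 ^+ n * q.2.[n%:R] = 0.
  move=> n; transitivity (\sum_(q <- (a, p) :: s) q.1 ^+ n.+1 * q.2.[n.+1%:R]
      - a * \sum_(q <- (a, p) :: s) q.1 ^+ n * q.2.[n%:R]); last first.
    by rewrite !E mulr0 subrr.
  rewrite mulr_sumr -sumrB.
  have -> : (a, T a p) :: s' = [seq (q.1, T q.1 q.2) | q <- (a, p) :: s] by [].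
  rewrite big_map; apply: eq_bigr => q _ /=.
  by rewrite /T !hornerE horner_succ exprS mulrBr !mulrA
    ![_ * q.1]mulrC ![_ * a]mulrC.
(* For [q] in the tail, the coefficient of [T q.1 q.2] at the degree of [q.2] is [q.1 - a] times the
   leading coefficient of [q.2]. Since [q.1 != a], the vanishing of [T q.1 q.2] forces [q.2 = 0],
   and only the head term is left. *)
have s0' : all (fun q => q.2 == 0) s.
  apply/allP => q qs.
  have /= /eqP := all0 _ (map_f (fun q => (q.1, T q.1 q.2)) qs).
  move=> Tq0; apply: contraT => q0.
  move: Tq0; have nqa : q.1 - a != 0.
    by rewrite subr_eq0; apply: contraNneq as_ => <-; apply: map_f.
  move/(congr1 (fun r : {poly D} => r`_(size q.2).-1)).
  rewrite /T coefB !coefZ coef0 -[in X in X - _](size_succ q.2) -!lead_coefE.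
  rewrite lead_succ -mulrBl => /eqP.
  by rewrite mulf_eq0 (negPf nqa) lead_coef_eq0 (negPf q0).
rewrite s0' andbT; apply/eqP/poly_nat_eq0 => n.
have := E n; rewrite big_cons /= [X in _ + X]big_seq big1 => [|q qs].
  by rewrite addr0 => /eqP; rewrite mulf_eq0 expf_eq0 (negPf a0) andbF => /eqP.
by rewrite (eqP (allP s0' q qs)) horner0 mulr0.
Qed.

(** Bases may repeat here: grouping the terms by the distinct values of [a] reduces the claim to
    pairwise distinct bases. *)
Lemma exp_poly (I : finType) (a : I -> D) (p : I -> {poly D}) :
    (forall i, a i != 0) ->
    (forall n : nat, \sum_i a i ^+ n * (p i).[n%:R] = 0) ->
  forall j, \sum_(i | a i == a j) p i = 0.
Proof.
move=> a0 E j; pose r := undup [seq a i | i : I].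
pose q b := \sum_(i | a i == b) p i.
have := @exp_poly_uniq [seq (b, q b) | b <- r].
rewrite /unzip1 -map_comp map_id undup_uniq !all_map.
have -> : all (preim (fun b => (b, q b)) (fun x => x.1 != 0)) r.
  by apply/allP => b /=; rewrite mem_undup => /mapP[i _ ->].
move=> /(_ isT isT) H.
have /H/allP/(_ (a j)) : forall n : nat,
    \sum_(x <- [seq (b, q b) | b <- r]) x.1 ^+ n * x.2.[n%:R] = 0.
  move=> n; rewrite -[RHS](E n) big_map.
  transitivity (\sum_(b <- r) \sum_i
      if a i == b then b ^+ n * (p i).[n%:R] else 0).
    by apply: eq_bigr => b _; rewrite -big_mkcond /= horner_sum mulr_sumr.
  rewrite exchange_big /=; apply: eq_bigr => i _.
  have ri : a i \in r.
    by rewrite mem_undup; apply/mapP; exists i; rewrite ?mem_enum.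
  rewrite (bigD1_seq (a i)) ?undup_uniq //= eqxx big1 ?addr0 // => b.
  by rewrite eq_sym => /negPf->.
rewrite mem_undup => H'; apply/eqP/H'.
by apply/mapP; exists j; rewrite ?mem_enum.
Qed.

(** This serves to compare two exponential terms with two others whose bases may or may not coincide
    with theirs; each conditional records one possible coincidence with [a]. *)
Lemma exp_poly4 (a b c d : D) (p q r s : {poly D}) :
    a != 0 -> b != 0 -> c != 0 -> d != 0 ->
    (forall n : nat, a ^+ n * p.[n%:R] + b ^+ n * q.[n%:R]
                   + c ^+ n * r.[n%:R] + d ^+ n * s.[n%:R] = 0) ->
  p + (if b == a then q else 0) + (if c == a then r else 0)
    + (if d == a then s else 0) = 0.
Proof.
move=> a0 b0 c0 d0 E.
pose base (i : 'I_4) : D := nth 0 [:: a; b; c; d] i.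
pose coef (i : 'I_4) := nth 0 [:: p; q; r; s] i.
have := @exp_poly _ base coef _ _ ord0.
rewrite big_mkcond !big_ord_recl big_ord0 /base /coef /= eqxx addr0.
rewrite !addrA; apply; first by case=> [[|[|[|[|]]]]].
by move=> n; rewrite -[RHS](E n) !big_ord_recl big_ord0 /= addr0 !addrA.
Qed.

Lemma exp_poly2 (a b : D) (p q : {poly D}) :
    a != 0 -> b != 0 -> a != b ->
    (forall n : nat, a ^+ n * p.[n%:R] + b ^+ n * q.[n%:R] = 0) ->
  p = 0 /\ q = 0.
Proof.
have aux (c d : D) (u v : {poly D}) : c != 0 -> d != 0 -> c != d ->
    (forall n : nat, c ^+ n * u.[n%:R] + d ^+ n * v.[n%:R] = 0) -> u = 0.
  (* The last two slots are filled with zero polynomials on the base [c]. *)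
  move=> c0 d0 cd F; have := @exp_poly4 c d c c u v 0 0 c0 d0 c0 c0.
  rewrite [d == c]eq_sym (negPf cd) eqxx !addr0; apply=> n.
  by rewrite !horner0 !mulr0 !addr0.
move=> a0 b0 ab E; split; first exact: (aux a b p q).
by apply: (aux b a q p) => // [|n]; rewrite 1?eq_sym 1?addrC.
Qed.

Lemma exp_linear_eq (a b u u' v v' w w' z z' : D) :
    a != 0 -> b != 0 -> a != b ->
    (forall n : nat, a ^+ n * (u + n%:R * u') + b ^+ n * (v + n%:R * v')
                   = a ^+ n * (w + n%:R * w') + b ^+ n * (z + n%:R * z')) ->
  [/\ u = w, u' = w', v = z & v' = z'].
Proof.
move=> a0 b0 ab E.
pose lin (x x' : D) : {poly D} := x%:P + x'%:P * 'X.
have lin0 x x' y y' : lin (x - y) (x' - y') = 0 -> x = y /\ x' = y'.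
  move=> h; split; apply/eqP; rewrite -subr_eq0; apply/eqP.
    move/(congr1 (fun r : {poly D} => r`_0)): h.
    by rewrite coefD coefC coefMX coef0 addr0.
  move/(congr1 (fun r : {poly D} => r`_1)): h.
  by rewrite coefD coefC coefMX coefC coef0 add0r.
suff [/lin0[-> ->] /lin0[-> ->]//] :
    lin (u - w) (u' - w') = 0 /\ lin (v - z) (v' - z') = 0.
apply: (exp_poly2 _ _ _ _ a0 b0 ab) => n.
have hl x x' y y' : (lin (x - y) (x' - y')).[n%:R]
    = (x + n%:R * x') - (y + n%:R * y').
  rewrite hornerD hornerMX !hornerC mulrBl ![_ * n%:R]mulrC opprD.
  by rewrite addrACA.
by rewrite !hl !mulrBr addrACA E -opprD subrr.
Qed.

(** Collecting the terms of base [a] in the difference of the two sides leaves the nonzero [p] alone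
    unless [c] or [d] equals [a]; the same holds for [b] and [q]. As [c != d], each of [a] and [b]
    is matched exactly once, and the matching polynomial is the constant. *)
Lemma exp_poly_match (a b c d p q : D) (r s : {poly D}) :
    a != 0 -> b != 0 -> c != 0 -> d != 0 -> p != 0 -> q != 0 ->
    a != b -> c != d ->
    (forall n : nat, a ^+ n * p + b ^+ n * q
                     = c ^+ n * r.[n%:R] + d ^+ n * s.[n%:R]) ->
  [/\ c = a, d = b, r = p%:P & s = q%:P] \/
  [/\ c = b, d = a, r = q%:P & s = p%:P].
Proof.
move=> a0 b0 c0 d0 p0 q0 ab cd E.
have := @exp_poly4 a b c d p%:P q%:P (- r) (- s) a0 b0 c0 d0.
have := @exp_poly4 b a c d q%:P p%:P (- r) (- s) b0 a0 c0 d0.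
rewrite [b == a]eq_sym (negPf ab) !addr0 => Eb Ea.
have {Ea} := Ea _; have {Eb} := Eb _ => Eb Ea.
have {}Eb : q%:P + (if c == b then - r else 0)
    + (if d == b then - s else 0) = 0.
  apply: Eb => n; rewrite !hornerC !hornerN [X in X + _ + _]addrC E.
  by rewrite !mulrN -addrA -opprD subrr.
have {}Ea : p%:P + (if c == a then - r else 0)
    + (if d == a then - s else 0) = 0.
  apply: Ea => n; rewrite !hornerC !hornerN E.
  by rewrite !mulrN -addrA -opprD subrr.
have sub_eq (x y : {poly D}) : x - y = 0 -> y = x.
  by move/eqP; rewrite subr_eq0 => /eqP.
have zP (x : D) : x != 0 -> x%:P != 0 by rewrite polyC_eq0.
have [ca|ca] := eqVneq c a; [left|right].
  move: Ea Eb; rewrite -ca eqxx [d == c]eq_sym (negPf cd).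
  move: ab; rewrite -ca => /negPf->; rewrite !addr0 => /sub_eq rE.
  have [db /sub_eq sE|_ /eqP] := eqVneq d b; first by [].
  by rewrite addr0 (negPf (zP _ q0)).
move: Ea Eb; rewrite (negPf ca) addr0.
have [da|_ /eqP] := eqVneq d a; last by rewrite addr0 (negPf (zP _ p0)).
move: ab; rewrite -da => /negPf->; move=> /sub_eq sE; rewrite addr0.
have [cb /sub_eq rE|_ /eqP] := eqVneq c b; first by [].
by rewrite addr0 (negPf (zP _ q0)).
Qed.

End ExpPoly.

(** * Substitution into multivariate polynomials *)

Lemma comp_mpolyA (R : comNzRingType) (n k h : nat) (f : {mpoly R[n]})
    (lq : n.-tuple {mpoly R[k]}) (lr : k.-tuple {mpoly R[h]}) :
  (f \mPo lq) \mPo lr = f \mPo [tuple tnth lq i \mPo lr | i < n].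
Proof.
rewrite (comp_mpolyE f) raddf_sum /= comp_mpolyE; apply: eq_bigr => m _.
rewrite comp_mpolyZ rmorph_prod; congr (_ *: _); apply: eq_bigr => i _.
by rewrite rmorphXn tnth_mktuple.
Qed.

Lemma eq_comp_mpoly (R : nzRingType) (n k : nat) (f : {mpoly R[n]})
    (t t' : n.-tuple {mpoly R[k]}) :
  tnth t =1 tnth t' -> f \mPo t = f \mPo t'.
Proof. by move=> /eq_from_tnth->. Qed.

Lemma comp_mpolyX_tnth (R : nzRingType) (n k : nat) (i : 'I_n)
    (t : n.-tuple {mpoly R[k]}) :
  'X_i \mPo t = tnth t i.
Proof. by rewrite comp_mpolyXU -tnth_nth. Qed.

(** Along a line, substitution is polynomial in the parameter [t], with coefficients in the
    multivariate ring. This is what lets a shift by [n] enter an exponential polynomial in [n]. *)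
Lemma comp_mpoly_line (R : comNzRingType) (n k : nat) (f : {mpoly R[n]})
    (u w : 'I_n -> {mpoly R[k]}) :
  exists q : {poly {mpoly R[k]}},
    forall t, q.[t] = f \mPo [tuple u i + t * w i | i < n].
Proof.
exists (\sum_(m <- msupp f) (f@_m)%:MP *:
          \prod_(i < n) ((u i)%:P + 'X * (w i)%:P) ^+ m i) => t.
rewrite horner_sum comp_mpolyE; apply: eq_bigr => m _.
rewrite hornerZ mul_mpolyC horner_prod; congr (_ *: _); apply: eq_bigr => i _.
by rewrite horner_exp tnth_mktuple !hornerE.
Qed.

(** * Shift operators on polynomials in four variables *)

Section Main.

Variable R : realType.
Let D := {mpoly R[i][4]}.

Let charK : has_char0 R[i].
Proof. exact: Num.Theory.pchar_num. Qed.

Let charD : has_char0 D.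
Proof.
apply/(pcharf0P D) => n; rewrite -(rmorph_nat (mpolyC 4 (R:=R[i]))).
by rewrite mpolyC_eq0; apply: (iffLR (pcharf0P _) charK).
Qed.

(** Scalar bases become constants of the domain [D], so that bases and coefficients live in one
    ring. *)
Lemma exp_poly2_mpoly (a b : R[i]) (p q : {poly D}) :
    a != 0 -> b != 0 -> a != b ->
    (forall n : nat, a ^+ n *: p.[n%:R] + b ^+ n *: q.[n%:R] = 0) ->
  p = 0 /\ q = 0.
Proof.
move=> a0 b0 ab E.
apply: (@exp_poly2 _ charD a%:MP b%:MP); rewrite ?mpolyC_eq0 ?mpolyC_eq //.
by move=> n; rewrite -[RHS](E n) -!rmorphXn !mul_mpolyC.
Qed.

Lemma exp_linear_eq_mpoly (a b : R[i]) (u u' v v' w w' z z' : D) :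
    a != 0 -> b != 0 -> a != b ->
    (forall n : nat,
       a ^+ n *: (u + n%:R *: u') + b ^+ n *: (v + n%:R *: v')
       = a ^+ n *: (w + n%:R *: w') + b ^+ n *: (z + n%:R *: z')) ->
  [/\ u = w, u' = w', v = z & v' = z'].
Proof.
move=> a0 b0 ab E.
have C0 (c : R[i]) : c != 0 -> c%:MP != 0 :> D by rewrite mpolyC_eq0.
have abC : a%:MP != b%:MP :> D by rewrite mpolyC_eq.
apply: (@exp_linear_eq D charD _ _ u u' v v' w w' z z' (C0 a a0) (C0 b b0) abC).
have key (c : R[i]) n (x y : D) :
    c%:MP ^+ n * (x + n%:R * y) = c ^+ n *: (x + n%:R *: y).
  by rewrite -rmorphXn mul_mpolyC scaler_nat mulr_natl.
by move=> n; rewrite [LHS](congr2 _ (key _ _ _ _) (key _ _ _ _)) E -!key.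
Qed.

(** The displacement vector of a shift. Seeing [shift] as a translation reduces composition of
    shifts to additivity of this vector, without a case split on the variables. *)
Let delta (k : bool) (a b : R[i]) (i : 'I_4) : R[i] :=
  if i == vX k then a else if i == vY k then b else 0.

Let deltaD (k : bool) (a b c d : R[i]) i :
  delta k (a + c) (b + d) i = delta k a b i + delta k c d i.
Proof. by rewrite /delta; do 2?case: ifP => // _; rewrite addr0. Qed.

Let deltaM (k : bool) (a b c : R[i]) i :
  delta k (c * a) (c * b) i = c * delta k a b i.
Proof. by rewrite /delta; do 2?case: ifP => // _; rewrite mulr0. Qed.

Lemma shiftE (k : bool) (a b : R[i]) (f : P4 R) :
  shift k a b f = f \mPo [tuple 'X_i - (delta k a b i)%:MP | i < 4].
Proof.
rewrite /shift; apply: eq_comp_mpoly => i.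
rewrite tnth_mktuple (tnth_nth 0) /delta.
(* Writing [i] through the list of named variables lets each case reduce to [vX] or [vY], whatever
   bound proof [i] carries. *)
have E0 : i = nth ord0 [:: vX false; vY false; vX true; vY true] i.
  by case: i => [[|[|[|[|]]]] Hi] //=; apply/val_inj.
rewrite [in RHS]E0; clear E0; case: i => [[|[|[|[|]]]] Hi] //=;
by case: k => //=; rewrite mpolyC0 subr0.
Qed.

Lemma shift_line (k : bool) (a a' b b' : R[i]) (f : P4 R) :
  exists q : {poly D}, forall n : nat,
    q.[n%:R] = shift k (a + n%:R * a') (b + n%:R * b') f.
Proof.
have [q qE] := @comp_mpoly_line _ 4 4 f
  (fun i => 'X_i - (delta k a b i)%:MP) (fun i => - (delta k a' b' i)%:MP).
exists q => n; rewrite qE shiftE.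
apply: eq_comp_mpoly => i; rewrite !tnth_mktuple mulrN -addrA -opprD.
by rewrite -(rmorph_nat (mpolyC 4 (R:=R[i]))) -mpolyCM -mpolyCD deltaD deltaM.
Qed.

Lemma shift_shift (k : bool) (a b c d : R[i]) (f : P4 R) :
  shift k a b (shift k c d f) = shift k (a + c) (b + d) f.
Proof.
rewrite !shiftE comp_mpolyA.
apply: eq_comp_mpoly => i; rewrite !tnth_mktuple comp_mpolyB comp_mpolyC.
by rewrite comp_mpolyX_tnth tnth_mktuple deltaD mpolyCD opprD addrA.
Qed.

Lemma shift1 (k : bool) (a b : R[i]) : shift k a b 1 = 1.
Proof. exact: comp_mpoly1. Qed.

Lemma shiftZ (k : bool) (a b c : R[i]) (f : P4 R) :
  shift k a b (c *: f) = c *: shift k a b f.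
Proof. exact: comp_mpolyZ. Qed.

(** With [c = s / s'], comparing the shifts by [(1, n)] and [(1, 0)] shows that the shift by
    [(0, n)] fixes [P]. Iterating the shift by [(1, 0)] multiplies [P] by [c ^+ n], whereas the
    result depends polynomially on [n]; hence [c = 1]. *)
Lemma shift_eigen (k : bool) (s s' : R[i]) (P : P4 R) :
    s != 0 -> s' != 0 -> P != 0 ->
    (forall n : nat, s' *: shift k 1 n%:R P = s *: P) ->
  s = s' /\ forall n : nat, shift k 0 n%:R P = P.
Proof.
move=> s0 s'0 P0 E; pose c := s / s'.
have c0 : c != 0 by rewrite mulf_neq0 ?invr_eq0.
have {}E n : shift k 1 n%:R P = c *: P.
  by rewrite /c mulrC -scalerA -(E n) scalerA mulVf // scale1r.
have E0 n : shift k 0 n%:R P = P.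
  apply: (scalerI c0); rewrite -shiftZ -[in LHS](E 0) shift_shift !add0r addr0.
  exact: E.
have En (n : nat) : shift k n%:R 0 P = c ^+ n *: P.
  elim: n => [|n IH]; first by rewrite (E0 0%N) expr0 scale1r.
  rewrite -natr1 addrC -[X in shift _ _ X](addr0 0) -shift_shift IH.
  by rewrite shiftZ (E 0%N) scalerA exprSr.
have [c1|c1] := eqVneq 1 c.
  by split=> //; rewrite -[s'](mul1r) c1 mulfVK.
(* The polynomial [q] interpolates the shifts by [(n, 0)], so [q(n) - c ^+ n *: P] vanishes
   identically. Independence of the bases [1] and [c] then gives [P = 0]. *)
have [q qE] := shift_line k 0 1 0 0 P.
have [_ /eqP] : q = 0 /\ - P%:P = 0.
  have c1' : (1 : R[i]) != c by [].
  apply: (@exp_poly2_mpoly 1 c q (- P%:P) (oner_neq0 _) c0 c1') => n.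
  rewrite qE !add0r mulr1 mulr0 En expr1n scale1r hornerN hornerC.
  by rewrite scalerN subrr.
by rewrite oppr_eq0 polyC_eq0 (negPf P0).
Qed.

(** Invariance removes the shift, so the action is [l ^+ n] times an expression affine in [n], the
    shape required by [exp_linear_eq_mpoly]. *)
Lemma omega_act_GL (k : bool) (l e s : R[i]) (n : nat) (f : P4 R) :
  shift k 0 n%:R f = f ->
  omega_act k l e s GL n f
    = l ^+ n *: ('X_(vY k) * f + n%:R *: (e *: f - 'X_(vX k) * f)).
Proof.
rewrite /omega_act -exprnP -pmulrn => ->; suff -> (x y g : D) :
  (y - n%:R *: x + (n%:R * e)%:MP) * g = y * g + n%:R *: (e *: g - x * g) by [].
rewrite mulrDl mulrBl mul_mpolyC -scalerAl scalerBr scalerA -addrA.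
by congr (_ + _); apply: addrC.
Qed.

Lemma tensor_act_GL (l1 e1 s1 l2 e2 s2 : R[i]) (n : nat) (f : P4 R) :
  shift false 0 n%:R f = f -> shift true 0 n%:R f = f ->
  tensor_act l1 e1 s1 l2 e2 s2 GL n f
    = l1 ^+ n *: ('X_(vY false) * f + n%:R *: (e1 *: f - 'X_(vX false) * f))
      + l2 ^+ n *: ('X_(vY true) * f + n%:R *: (e2 *: f - 'X_(vX true) * f)).
Proof.
move=> /omega_act_GL h1 /omega_act_GL h2.
exact: (congr2 +%R (h1 _ _ _) (h2 _ _ _)).
Qed.

(** * Exchange of the two tensor factors *)

Let sigma (i : 'I_4) : 'I_4 :=
  nth ord0 [:: vX true; vY true; vX false; vY false] i.

Let sigmaK : involutive sigma.
Proof. by case=> [[|[|[|[|]]]] Hi] //; apply/val_inj. Qed.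

Let delta_sigma (k : bool) (a b : R[i]) i :
  delta (~~ k) a b (sigma i) = delta k a b i.
Proof. by case: k; case: i => [[|[|[|[|]]]] Hi]. Qed.

(** In terms of tensors this is the flip of [v (x) w] to [w (x) v]. *)
Definition swap (f : P4 R) : P4 R := f \mPo [tuple 'X_(sigma i) | i < 4].

Lemma swapK : involutive swap.
Proof.
move=> f; rewrite /swap comp_mpolyA.
rewrite -[RHS]comp_mpoly_id; apply: eq_comp_mpoly => i; rewrite !tnth_mktuple.
by rewrite comp_mpolyX_tnth tnth_mktuple sigmaK.
Qed.

Lemma swap_shift (k : bool) (a b : R[i]) (f : P4 R) :
  swap (shift k a b f) = shift (~~ k) a b (swap f).
Proof.
rewrite /swap !shiftE !comp_mpolyA.
apply: eq_comp_mpoly => i; rewrite [LHS]tnth_mktuple [RHS]tnth_mktuple.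
rewrite [in LHS]tnth_mktuple [in RHS]tnth_mktuple comp_mpolyB comp_mpolyC.
rewrite !comp_mpolyX_tnth [in LHS]tnth_mktuple [in RHS]tnth_mktuple.
by rewrite delta_sigma.
Qed.

Lemma swapX (k : bool) : (swap 'X_(vX k) = 'X_(vX (~~ k)))
                       * (swap 'X_(vY k) = 'X_(vY (~~ k))).
Proof.
have sX i : swap 'X_i = 'X_(sigma i).
  by rewrite /swap comp_mpolyX_tnth tnth_mktuple.
by rewrite !sX; have [-> ->] : sigma (vX k) = vX (~~ k)
  /\ sigma (vY k) = vY (~~ k) by case: k.
Qed.

Lemma swap_omega_act (k : bool) (l e s : R[i]) g m (f : P4 R) :
  swap (omega_act k l e s g m f) = omega_act (~~ k) l e s g m (swap f).
Proof.
have sM : {morph swap : u v / u * v} := rmorphM _.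
have sB : {morph swap : u v / u - v} := comp_mpolyB _.
have sD : {morph swap : u v / u + v} := comp_mpolyD _.
have sZ c : {morph swap : u / c *: u} by move=> u; apply: comp_mpolyZ.
have sC c : swap c%:MP = c%:MP by apply: comp_mpolyC.
case: g => /=; last exact: comp_mpoly0; rewrite sZ ?sM ?swap_shift //.
- by rewrite sD sB sZ sC !swapX.
- by rewrite swapX.
Qed.

Lemma gmod_isomorphic_swap (l1 e1 s1 l2 e2 s2 : R[i]) :
  gmod_isomorphic (tensor_act l1 e1 s1 l2 e2 s2)
                  (tensor_act l2 e2 s2 l1 e1 s1).
Proof.
exists swap; split; last 1 first.
- move=> g m f; rewrite /tensor_act.
  transitivity (swap (omega_act false l1 e1 s1 g m f)
                + swap (omega_act true l2 e2 s2 g m f)).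
    exact: comp_mpolyD.
  have := congr2 +%R (swap_omega_act false l1 e1 s1 g m f)
                     (swap_omega_act true l2 e2 s2 g m f).
  by move=> ->; apply: addrC.
- by move=> c u v; rewrite /swap comp_mpolyD comp_mpolyZ.
- exact/inv_bij/swapK.
Qed.

Lemma gmod_isomorphic_refl (act : gca_gen -> int -> P4 R -> P4 R) :
  gmod_isomorphic act act.
Proof. by exists id; split=> //; exists id. Qed.

Lemma gmod_isomorphic_trans (act1 act2 act3 : gca_gen -> int -> P4 R -> P4 R) :
  gmod_isomorphic act1 act2 -> gmod_isomorphic act2 act3 ->
  gmod_isomorphic act1 act3.
Proof.
move=> [f [fL fB fA]] [g [gL gB gA]]; exists (g \o f); split.
- by move=> c u v; rewrite /= fL gL.
- exact: bij_comp.
- by move=> x m u; rewrite /= fA gA.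
Qed.

(** * Parameters recovered from an isomorphism *)

Section Iso.

Variables (l1 l2 l1' l2' s1 s2 s1' s2' e1 e2 e1' e2' : R[i]).
Hypotheses (l10 : l1 != 0) (l20 : l2 != 0) (l10' : l1' != 0) (l20' : l2' != 0).
Hypotheses (s10 : s1 != 0) (s20 : s2 != 0) (s10' : s1' != 0) (s20' : s2' != 0).
Hypotheses (l12 : l1 != l2) (l12' : l1' != l2').
Variable phi : P4 R -> P4 R.
Hypothesis phiL : forall (c : R[i]) u v, phi (c *: u + v) = c *: phi u + phi v.
Hypothesis phiI : injective phi.
Hypothesis phiA : forall g m f,
  phi (tensor_act l1 e1 s1 l2 e2 s2 g m f)
    = tensor_act l1' e1' s1' l2' e2' s2' g m (phi f).

Let P := phi 1.

Let phi0 : phi 0 = 0.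
Proof. by have := phiL (-1) 0 0; rewrite scaler0 addr0 scaleN1r addNr. Qed.

Let phiZ c u : phi (c *: u) = c *: phi u.
Proof. by rewrite -[c *: u]addr0 phiL phi0 addr0. Qed.

Let phiD u v : phi (u + v) = phi u + phi v.
Proof. by rewrite -[u]scale1r phiL !scale1r. Qed.

Let phiB u v : phi (u - v) = phi u - phi v.
Proof. by rewrite phiD -scaleN1r phiZ scaleN1r. Qed.

Let P0 : P != 0.
Proof. by rewrite -phi0 (inj_eq phiI) oner_neq0. Qed.

Let actI (n : nat) : l1 ^+ n *: (s1 *: P) + l2 ^+ n *: (s2 *: P)
  = l1' ^+ n *: (s1' *: shift false 1 n%:R P)
    + l2' ^+ n *: (s2' *: shift true 1 n%:R P).
Proof.
have := phiA GI (Posz n) 1.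
by rewrite /tensor_act /= !shift1 phiD !phiZ !scalerA.
Qed.

Let shift_poly (k : bool) (s : R[i]) : exists q : {poly D},
  forall n : nat, q.[n%:R] = s *: shift k 1 n%:R P.
Proof.
have [q qE] := shift_line k 1 0 0 1 P; exists (s%:MP *: q) => n.
by rewrite hornerZ mul_mpolyC qE mulr0 addr0 mulr1 add0r.
Qed.

(** The coefficients [s1 *: P] and [s2 *: P] are nonzero in the domain [D], so [exp_poly_match]
    applies over [D]. The crossed alternative keeps only the bases, because it will be reduced to
    the straight one by the flip. *)
Lemma iso_match :
  [/\ l1' = l1, l2' = l2,
      forall n : nat, s1' *: shift false 1 n%:R P = s1 *: P &
      forall n : nat, s2' *: shift true 1 n%:R P = s2 *: P] \/
  (l1' = l2 /\ l2' = l1).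
Proof.
have [q1 q1E] := shift_poly false s1'; have [q2 q2E] := shift_poly true s2'.
have C0 (c : R[i]) : c != 0 -> c%:MP != 0 :> D by rewrite mpolyC_eq0.
have Z0 (c : R[i]) : c != 0 -> c *: P != 0.
  by move=> c0; rewrite scaler_eq0 negb_or c0 P0.
have CI (c d : R[i]) : c%:MP = d%:MP :> D -> c = d.
  by move/eqP; rewrite mpolyC_eq => /eqP.
have := @exp_poly_match D charD _ _ _ _ _ _ q1 q2 (C0 _ l10) (C0 _ l20)
  (C0 _ l10') (C0 _ l20') (Z0 _ s10) (Z0 _ s20).
rewrite !mpolyC_eq => /(_ l12 l12') [].
- by move=> n; rewrite -!rmorphXn !mul_mpolyC actI q1E q2E.
- move=> [/CI-> /CI-> r1 r2]; left; split=> // n.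
    by rewrite -q1E r1 hornerC.
  by rewrite -q2E r2 hornerC.
- by move=> [/CI-> /CI-> _ _]; right.
Qed.

(** Since [l1 != l2], the hypothesis selects the straight alternative of [iso_match]. *)
Lemma iso_params : l1' = l1 ->
  (l1, e1, s1) = (l1', e1', s1') /\ (l2, e2, s2) = (l2', e2', s2').
Proof.
move=> l1l1'; have [[ll1 ll2 E1 E2]|[l1l2 _]] := iso_match; last first.
  by move: l12; rewrite -l1l2 l1l1' eqxx.
have [ss1 sh1] := shift_eigen _ _ _ _ s10 s10' P0 E1.
have [ss2 sh2] := shift_eigen _ _ _ _ s20 s20' P0 E2.
have sh11 k n : shift k 0 n%:R 1 = 1 := shift1 k _ _.
(* The action of [H_n] has no term linear in [n] here; zeros are inserted to fit the affine form. *)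
have H (n : nat) : l1 ^+ n *: (phi ('X_(vX false) * 1) + n%:R *: 0)
    + l2 ^+ n *: (phi ('X_(vX true) * 1) + n%:R *: 0)
  = l1 ^+ n *: ('X_(vX false) * P + n%:R *: 0)
    + l2 ^+ n *: ('X_(vX true) * P + n%:R *: 0).
  have := phiA GH n 1; rewrite /tensor_act /omega_act -!exprnP -!pmulrn.
  by rewrite sh1 sh2 !sh11 phiD !phiZ ll1 ll2 scaler0 !addr0.
have [X1 _ X2 _] := exp_linear_eq_mpoly _ _ _ _ _ _ _ _ _ _ l10 l20 l12 H.
(* Both [1] and [P] are invariant under the shifts of [Y1] and [Y2], so the affine form of [L_n] is
   available on both sides. *)
have L (n : nat) :
  l1 ^+ n *: (phi ('X_(vY false) * 1)
              + n%:R *: (e1 *: P - phi ('X_(vX false) * 1)))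
    + l2 ^+ n *: (phi ('X_(vY true) * 1)
                  + n%:R *: (e2 *: P - phi ('X_(vX true) * 1)))
  = l1' ^+ n *: ('X_(vY false) * P + n%:R *: (e1' *: P - 'X_(vX false) * P))
    + l2' ^+ n *: ('X_(vY true) * P + n%:R *: (e2' *: P - 'X_(vX true) * P)).
  have phi_lin (c k e : R[i]) x y :
      phi (c *: (x + k *: (e *: 1 - y))) = c *: (phi x + k *: (e *: P - phi y)).
    by rewrite phiZ phiD phiZ phiB phiZ.
  have h := phiA GL n 1.
  rewrite (tensor_act_GL _ _ _ _ _ _ n 1 (sh11 _ _) (sh11 _ _)) in h.
  rewrite (tensor_act_GL _ _ _ _ _ _ n P (sh1 n) (sh2 n)) in h.
  apply: etrans h; apply/esym; apply: etrans (phiD _ _) _.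
  exact: (congr2 +%R (phi_lin _ _ _ _ _) (phi_lin _ _ _ _ _)).
move: L; rewrite ll1 ll2 => L.
(* Only the coefficients of [n] are kept: they compare [e *: P - phi(Xi)] with [e' *: P - Xi P],
   where the terms in [Xi] cancel by [X1] and [X2]. *)
have [_ E3 _ E4] := exp_linear_eq_mpoly _ _ _ _ _ _ _ _ _ _ l10 l20 l12 L.
have eP (e e' : R[i]) (x : D) : e *: P - x = e' *: P - x -> e = e'.
  move=> /addIr /eqP; rewrite -subr_eq0 -scalerBl scaler_eq0 (negPf P0) orbF.
  by rewrite subr_eq0 => /eqP.
move: E3 E4; rewrite X1 X2 => /eP <- /eP <-.
by rewrite ss1 ss2.
Qed.

End Iso.

End Main.

Theorem theorem4p7 (R : realType)
    (l1 l2 l1' l2' s1 s2 s1' s2' e1 e2 e1' e2' : R[i]) :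
  l1 != 0 -> l2 != 0 -> l1' != 0 -> l2' != 0 ->
  s1 != 0 -> s2 != 0 -> s1' != 0 -> s2' != 0 ->
  l1 != l2 -> l1' != l2' ->
  (gmod_isomorphic (tensor_act l1 e1 s1 l2 e2 s2)
                   (tensor_act l1' e1' s1' l2' e2' s2')
   <->
   ((l1, e1, s1) = (l1', e1', s1') /\ (l2, e2, s2) = (l2', e2', s2'))
   \/ ((l1, e1, s1) = (l2', e2', s2') /\ (l2, e2, s2) = (l1', e1', s1'))).
Proof.
move=> l10 l20 l10' l20' s10 s20 s10' s20' l12 l12'; split; last first.
  move=> [] [[-> -> ->] [-> -> ->]]; first exact: gmod_isomorphic_refl.
  exact: gmod_isomorphic_swap.
move=> iso; have [phi [phiL phiB phiA]] := iso.
have phiI := bij_inj phiB.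
have [[ll1 _ _ _]|[_ ll]] := iso_match R l1 l2 l1' l2' s1 s2 s1' s2' e1 e2
  e1' e2' l10 l20 l10' l20' s10 s20 l12 l12' phi phiL phiI phiA.
  left.
  by apply: (iso_params R l1 l2 l1' l2' s1 s2 s1' s2' e1 e2
  e1' e2' l10 l20 l10' l20' s10 s20 s10' s20' l12 l12' phi).
(* In the crossed case, following the isomorphism by the flip of the target exchanges the primed
   parameters, and the first bases now agree. *)
right; have [psi [psiL psiB psiA]] :=
  gmod_isomorphic_trans _ _ _ _ iso (gmod_isomorphic_swap _ _ _ _ _ _ _).
rewrite eq_sym in l12'.
by apply: (iso_params R l1 l2 l2' l1' s1 s2 s2' s1' e1 e2
  e2' e1' l10 l20 l20' l10' s10 s20 s20' s10' l12 l12' psi psiL (bij_inj psiB)).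
Qed.
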